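(* For any $\epsilon,\delta>0$ and any distribution $\mathcal{D}$ over component maintenance games with $n$ agents (with repair costs at most $H$), $O\!\left(\frac{n^2H^2}{\epsilon^2}\left(n^2+\log\frac1\delta\right)\right)$ games drawn i.i.d. from $\mathcal{D}$ suffice to ensure that, with probability at least $1-\delta$ over the draw, the subsidy vector $\hat\sigma\in[0,H]^n$ minimizing the average loss $L_{\mathrm{prior}}$ over the sample has expected loss $\mathbb{E}_{G\sim\mathcal{D}}[L^G_{\mathrm{prior}}(\hat\sigma)]$ at most $\epsilon$ larger than that of the best subsidy vector over $\mathcal{D}$, $\min_{\sigma\in[0,H]^n}\mathbb{E}_{G\sim\mathcal{D}}[L^G_{\mathrm{prior}}(\sigma)]$.
   Context: Component maintenance game with $n$ agents: agent $i$ owns component $i$ with random state $x_i\in\{0,1\}$ under a common prior $\theta$ (independent components), Boolean system function $\phi$, repair costs $C_i\le H$. Agent $i$ chooses $s_i\in\{0,1\}$ (1 = repair); post-action state $x_i'=\max\{x_i,s_i\}$; expected cost $l_i(s)=C_is_i+1-\mathbb{E}_\theta[\phi(\bm{x}'(s))]$. A (non-uniform) subsidy scheme is a vector $\sigma=(\sigma_1,\dots,\sigma_n)\in[0,H]^n$: agent $i$ receives $\mathrm{subs}_i(s)=\sigma_is_i$, with subsidized cost $l_i(s)-\mathrm{subs}_i(s)$, $\mathrm{cost}^\sigma(s)=\sum_i(l_i(s)-\mathrm{subs}_i(s))$ and $\mathrm{subs}(s)=\sum_i\mathrm{subs}_i(s)$. With $\mathcal{S}_{NE}(\sigma)$ the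 pure Nash equilibria of the subsidized game, the loss of game $G$ is $L^G_{\mathrm{prior}}(\sigma)=\max_{s\in\mathcal{S}_{NE}(\sigma)}\mathrm{cost}^\sigma(s)+\mathrm{subs}(s)$ (at most $(2H+1)n$).
   Formalization: The formal theorem assumes H ≥ 1 (and repair costs in [0,H]): the loss range is of order n(H+1), so with a universal constant the stated bound is false as H tends to 0, e.g. for n = 2 with a coordination game where a tiny subsidy changes the loss from 2 to H. *)

(* Defs.v *)
From HB Require Import structures.
From mathcomp Require Import all_boot all_order all_algebra.
From mathcomp Require Import all_classical all_reals all_analysis.
Set Implicit Arguments. Unset Strict Implicit. Unset Printing Implicit Defensive.
Import Order.TTheory GRing.Theory Num.Theory.
Local Open Scope ring_scope.
Local Open Scope classical_set_scope.

Section CMG.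
Variable R : realType.
Variable n : nat.

(* pure strategy profiles / component states: vectors in {0,1}^n *)
Definition profile := {ffun 'I_n -> bool}.

(* A component maintenance game: common prior theta (theta i = Pr[x_i = 1],
   components independent), repair costs C, Boolean system function phi. *)
Record cmgame := CMGame {
  theta : 'I_n -> R ;
  cost  : 'I_n -> R ;
  sysf  : profile -> bool }.

Definition valid_game (H : R) (G : cmgame) : Prop :=
  (forall i, 0 <= theta G i <= 1) /\ (forall i, 0 <= cost G i <= H).

Definition post_state (x s : profile) : profile := [ffun i => x i || s i].

Definition prior_prob (G : cmgame) (x : profile) : R :=
  \prod_(i < n) (if x i then theta G i else 1 - theta G i).

Definition exp_phi (G : cmgame) (s : profile) : R :=
  \sum_(x : profile) prior_prob G x * ((sysf G (post_state x s) : nat)%:R).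

Definition agent_cost (G : cmgame) (i : 'I_n) (s : profile) : R :=
  cost G i * ((s i : nat)%:R) + 1 - exp_phi G s.

Definition subsidy_scheme (H : R) (sigma : 'I_n -> R) : Prop :=
  forall i, 0 <= sigma i <= H.

Definition subs_i (sigma : 'I_n -> R) (i : 'I_n) (s : profile) : R :=
  sigma i * ((s i : nat)%:R).

Definition subs_cost_i (G : cmgame) (sigma : 'I_n -> R) (i : 'I_n) (s : profile) : R :=
  agent_cost G i s - subs_i sigma i s.

Definition cost_sigma (G : cmgame) (sigma : 'I_n -> R) (s : profile) : R :=
  \sum_(i < n) subs_cost_i G sigma i s.

Definition subs_total (sigma : 'I_n -> R) (s : profile) : R :=
  \sum_(i < n) subs_i sigma i s.

Definition deviate (s : profile) (i : 'I_n) (b : bool) : profile :=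
  [ffun j => if j == i then b else s j].

Definition is_pure_NE (G : cmgame) (sigma : 'I_n -> R) (s : profile) : bool :=
  [forall i, forall b : bool,
     subs_cost_i G sigma i s <= subs_cost_i G sigma i (deviate s i b)].

(* L^G_prior(sigma) = max_{s in S_NE(sigma)} cost^sigma(s) + subs(s).
   (The NE set is nonempty -- potential game -- and these values are >= 0
   for valid games, so the default 0 of the max is never active.) *)
Definition loss_prior (G : cmgame) (sigma : 'I_n -> R) : R :=
  \big[Num.max/0]_(s : profile | is_pure_NE G sigma s)
     (cost_sigma G sigma s + subs_total sigma s).

End CMG.

Definition iid_sample {R : realType} {d d' : measure_display}
    {T : measurableType d} {Omega : measurableType d'}
    (P : probability T R) (Q : probability Omega R) (m : nat)
    (X : 'I_m -> Omega -> T) : Prop :=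
  (forall j, measurable_fun setT (X j)) /\
  (forall A : 'I_m -> set T, (forall j, measurable (A j)) ->
     Q (\big[setI/setT]_(j < m) (X j @^-1` A j)) = (\prod_(j < m) P (A j))%E).

Definition emp_loss {R : realType} {n m : nat} (S : 'I_m -> cmgame R n)
    (sigma : 'I_n -> R) : R :=
  (m%:R)^-1 * \sum_(j < m) loss_prior (S j) sigma.

(* Main.v *)
Require Import Defs.
From HB Require Import structures.
From mathcomp Require Import all_boot all_order all_algebra.
From mathcomp Require Import all_classical all_reals all_analysis.
From mathcomp Require Import measurable_realfun.
From mathcomp Require Import zify ring lra.
Import Order.TTheory GRing.Theory Num.Theory.
Set Implicit Arguments.
Unset Strict Implicit.
Unset Printing Implicit Defensive.
Local Open Scope ring_scope.
Local Open Scope classical_set_scope.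

(**
For a fixed game, every agent compares its subsidy with at most 2^n thresholds,
so the loss is constant on the cells of an axis-parallel grid, and it is upper
semicontinuous because small perturbations can only destroy equilibria.

Only a one-sided uniform bound is needed: the empirical loss must not
underestimate the expected loss of any subsidy vector, and must not
overestimate it at one fixed nearly optimal vector.  The one-sided bound comes
from chaining with lower brackets.  Cutting each axis at the quantiles of the
thresholds gives cells on which a random game has constant loss except with
probability 2^-k; the minima of the loss over the cells increase with k, and
their successive increments are nonnegative with second moment at most 2^(1-k).
For nonnegative variables the lower tail is subgaussian with the second moment
as variance proxy, so the union bound over the (2^(2n+k+2))^n cells of level k
sums up without a logarithmic factor.

The losses are only measurable for each fixed subsidy vector, so the uniform
event is first restricted to countably many vectors.  They are chosen dense in
the graph of the expected loss, and upper semicontinuity of the empirical loss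
extends the bound to all vectors.  For finitely many vectors, rounding the
losses reduces the concentration argument to a finite probability space.
*)

(** * Finite probability spaces: union bounds and a lower-tail inequality *)

(** Since [expR x >= 1 + x], it suffices that (1 - x + x^2)(1 + x) = 1 + x^3 is at least 1. *)
Lemma expRN_le (R : realType) (x : R) : 0 <= x -> expR (- x) <= 1 - x + x ^+ 2.
Proof.
move=> x0; rewrite expRN.
have x1 : 0 < 1 + x by lra.
apply: (@le_trans _ _ (1 + x)^-1); first by rewrite lef_pV2 ?posrE ?expR_gt0 ?expR_ge1Dx.
rewrite -[leLHS]mul1r ler_pdivrMr // (_ : _ * _ = 1 + x ^+ 3); last by ring.
by rewrite lerDl exprn_ge0.
Qed.

Section FiniteProbability.
Variables (R : realType) (W : finType) (p : W -> R).
Hypothesis p_ge0 : forall w, 0 <= p w.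
Hypothesis p_sum1 : \sum_w p w = 1.

Definition mean (h : W -> R) : R := \sum_w p w * h w.

Definition iid_pr (m : nat) (A : pred {ffun 'I_m -> W}) : R :=
  \sum_(ws | A ws) \prod_(k < m) p (ws k).

Lemma mean_le (f g : W -> R) : (forall w, f w <= g w) -> mean f <= mean g.
Proof. by move=> fg; apply: ler_sum => w _; rewrite ler_wpM2l. Qed.

Lemma mean_cst (c : R) : mean (fun=> c) = c.
Proof. by rewrite /mean -mulr_suml p_sum1 mul1r. Qed.

Lemma meanD (f g : W -> R) : mean (fun w => f w + g w) = mean f + mean g.
Proof. by rewrite /mean -big_split; apply: eq_bigr => w _; rewrite mulrDr. Qed.

Lemma meanN (f : W -> R) : mean (fun w => - f w) = - mean f.
Proof. by rewrite /mean -sumrN; apply: eq_bigr => w _; rewrite mulrN. Qed.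

Lemma meanZ (c : R) (f : W -> R) : mean (fun w => c * f w) = c * mean f.
Proof. by rewrite /mean mulr_sumr; apply: eq_bigr => w _; rewrite mulrCA. Qed.

Lemma mean_sum (I : finType) (F : I -> W -> R) :
  mean (fun w => \sum_i F i w) = \sum_i mean (F i).
Proof.
by rewrite /mean exchange_big; apply: eq_bigr => w _; rewrite mulr_sumr.
Qed.

Lemma prod_p_ge0 m (ws : {ffun 'I_m -> W}) : 0 <= \prod_(k < m) p (ws k).
Proof. exact: prodr_ge0. Qed.

Lemma iid_pr_le m (A B : pred {ffun 'I_m -> W}) :
  (forall ws, A ws -> B ws) -> iid_pr A <= iid_pr B.
Proof.
move=> AB; rewrite /iid_pr [leLHS]big_mkcond [leRHS]big_mkcond.
apply: ler_sum => ws _.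
by case: ifPn => [/AB -> //|_]; case: ifPn => // _; exact: prod_p_ge0.
Qed.

Lemma iid_pr_exists (I : finType) m (A : I -> pred {ffun 'I_m -> W}) :
  iid_pr [pred ws | [exists i, A i ws]] <= \sum_i iid_pr (A i).
Proof.
rewrite /iid_pr [leRHS](_ : _ = \sum_i \sum_ws
    (if A i ws then \prod_(k < m) p (ws k) else 0)); last first.
  by apply: eq_bigr => i _; rewrite big_mkcond.
rewrite exchange_big /= [leLHS]big_mkcond; apply: ler_sum => ws _.
have ge0 i : 0 <= (if A i ws then \prod_(k < m) p (ws k) else 0).
  by case: ifP => // _; exact: prod_p_ge0.
case: ifPn => [/existsP[i Ai]|_]; last exact: sumr_ge0.
by rewrite (bigD1 i) //= Ai lerDl sumr_ge0.
Qed.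

(** Events of the same class coincide, so the union bound pays for the number of classes and not for
    the number of indices. *)
Lemma iid_pr_exists_class (J C : finType) (kappa : J -> C) m
    (A : J -> pred {ffun 'I_m -> W}) (b : R) :
    0 <= b -> (forall j j' ws, kappa j = kappa j' -> A j ws = A j' ws) ->
    (forall j, iid_pr (A j) <= b) ->
  iid_pr [pred ws | [exists j, A j ws]] <= #|C|%:R * b.
Proof.
move=> b0 Aclass Ab.
pose B c := [pred ws | [exists j, (kappa j == c) && A j ws]].
apply: (@le_trans _ _ (iid_pr [pred ws | [exists c, B c ws]])).
  apply: iid_pr_le => ws /= /existsP[j Aj].
  by apply/existsP; exists (kappa j); apply/existsP; exists j; rewrite eqxx.
apply: (le_trans (iid_pr_exists _)).
rewrite mulr_natl -sumr_const; apply: ler_sum => c _.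
have [[j jc]|noj] := pselect (exists j, kappa j = c).
  apply: (le_trans _ (Ab j)); apply: iid_pr_le => ws /= /existsP[j' /andP[/eqP j'c]].
  by rewrite (Aclass j' j) // j'c jc.
rewrite /iid_pr big_pred0 // => ws; apply/existsP => -[j /andP[/eqP jc _]].
by apply: noj; exists j.
Qed.

(* For nonnegative variables the lower tail is subgaussian with the second
   moment as variance proxy: there is no linear term as in Bernstein's bound. *)
Lemma iid_pr_lower_tail (m : nat) (h : W -> R) (v a : R) :
    (forall w, 0 <= h w) -> mean (fun w => h w ^+ 2) <= v -> 0 < v -> 0 <= a ->
  iid_pr [pred ws : {ffun 'I_m -> W} |
            \sum_(k < m) h (ws k) <= m%:R * (mean h - a)]
    <= expR (- (m%:R * a ^+ 2 / (4 * v))).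
Proof.
(* This [lam] minimizes the Chernoff exponent [lam ^+ 2 * v - lam * a], with minimum -a^2 / (4v). *)
move=> h0 hv v0 a0; pose lam := a / (2 * v).
have lam0 : 0 <= lam by rewrite divr_ge0 // mulr_ge0 // ltW.
have mgf : \sum_w p w * expR (- (lam * h w)) <= expR (- lam * mean h + lam ^+ 2 * v).
  apply: (@le_trans _ _ (mean (fun w => 1 + (- lam * h w + lam ^+ 2 * h w ^+ 2)))).
    apply: ler_sum => w _; rewrite ler_wpM2l //.
    have := @expRN_le R (lam * h w) (mulr_ge0 lam0 (h0 w)).
    by rewrite (_ : 1 - _ + _ = 1 + (- lam * h w + lam ^+ 2 * h w ^+ 2)) //; ring.
  rewrite !meanD !meanZ mean_cst.
  apply: le_trans (expR_ge1Dx _); rewrite lerD2l lerD2l ler_wpM2l //.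
  by rewrite exprn_ge0.
(* Markov's inequality for the exponential; independence then factors the sum into an m-th power. *)
apply: (@le_trans _ _ (\sum_(ws : {ffun 'I_m -> W}) \prod_(k < m) p (ws k) *
    expR (lam * (m%:R * (mean h - a) - \sum_(k < m) h (ws k))))).
  rewrite /iid_pr big_mkcond; apply: ler_sum => ws _; case: ifPn => /= [hA|_].
    rewrite -[leLHS]mulr1 ler_wpM2l ?prod_p_ge0 //.
    by rewrite -[leLHS]expR0 ler_expR mulr_ge0 // subr_ge0.
  by rewrite mulr_ge0 ?prod_p_ge0 ?expR_ge0.
rewrite (_ : \sum_ws _ = expR (lam * (m%:R * (mean h - a))) *
    (\sum_w p w * expR (- (lam * h w))) ^+ m); last first.
  have -> : (\sum_w p w * expR (- (lam * h w))) ^+ m =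
      \prod_(k < m) \sum_w p w * expR (- (lam * h w)).
    by rewrite prodr_const card_ord.
  rewrite bigA_distr_bigA mulr_sumr; apply: eq_bigr => ws _.
  rewrite big_split /= mulrCA; congr (_ * _).
  by rewrite -expR_sum -expRD; congr expR; rewrite sumrN -mulr_sumr mulrBr.
apply: (@le_trans _ _ (expR (lam * (m%:R * (mean h - a))) *
   expR (- lam * mean h + lam ^+ 2 * v) ^+ m)).
  rewrite ler_wpM2l ?expR_ge0 // lerXn2r ?nnegrE ?expR_ge0 //.
  by apply: sumr_ge0 => w _; rewrite mulr_ge0 ?expR_ge0.
rewrite -expRM_natl -expRD ler_expR le_eqVlt; apply/orP; left; apply/eqP.
by rewrite /lam; field; rewrite gt_eqF.
Qed.

End FiniteProbability.

(** * Chaining with lower brackets over nested quantile cells *)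

Lemma truncn_dist (R : realType) (y z : R) : 0 <= y -> 0 <= z ->
  Num.truncn y = Num.truncn z -> z - y < 1.
Proof.
move=> /truncn_itv /andP[y0 y1] /truncn_itv /andP[z0 z1] yz.
move: y0 z1; rewrite yz -natr1 => y0 z1; lra.
Qed.

(** Doubling the scale refines the bins: the finer floor determines the coarser one. *)
Lemma truncn_half (R : realType) (y : R) : 0 <= y ->
  Num.truncn y = (Num.truncn (y * 2))./2.
Proof.
move=> y0; have y20 : 0 <= y * 2 by rewrite mulr_ge0.
have /andP[a1 a2] := truncn_itv y0; have /andP[b1 b2] := truncn_itv y20.
set a := Num.truncn y in a1 a2 *; set b := Num.truncn _ in b1 b2 *.
have : (a * 2 < b.+1)%N.
  by rewrite -(ltr_nat R) natrM (le_lt_trans _ b2) // ler_pM2r.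
have : (b < a.+1 * 2)%N.
  by rewrite -(ltr_nat R) natrM (le_lt_trans b1) // ltr_pM2r.
lia.
Qed.

Section Chaining.
Variables (R : realType) (W : finType) (p : W -> R).
Hypothesis p_ge0 : forall w, 0 <= p w.
Hypothesis p_sum1 : \sum_w p w = 1.
Variables (n : nat) (J S : finType).
Hypothesis n_gt0 : (0 < n)%N.
Hypothesis cardS : (#|S| <= 2 ^ n)%N.
Variables (x : 'I_n -> J -> R) (tau : 'I_n -> S -> W -> R) (f : W -> J -> R).
Hypothesis f01 : forall w j, 0 <= f w j <= 1.

(** Strict and weak comparisons are both recorded, because a point lying exactly on a threshold (an
    indifferent agent) counts as a cell of its own. *)
Definition same_side (i : 'I_n) (w : W) (y z : R) : bool :=
  [forall s, ((tau i s w < y) == (tau i s w < z)) &&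
             ((tau i s w <= y) == (tau i s w <= z))].

Hypothesis f_same_side : forall w j j',
  (forall i, same_side i w (x i j) (x i j')) -> f w j = f w j'.

(** Each threshold counts once when reached and once more when exceeded, so that even moving onto it
    raises the count by one. The mean [crossed] acts as an unnormalized distribution function. *)
Let passed (i : 'I_n) (y : R) (w : W) : R :=
  \sum_s ((tau i s w < y)%R%:R + (tau i s w <= y)%R%:R).

Let crossed (i : 'I_n) (y : R) : R := mean p (passed i y).

(** A bin on one axis then carries [crossed] mass below 1 / (n 2^k); the factor [n] pays for the
    union over the axes. *)
Let scale (k : nat) : R := n%:R * 2 ^+ k.

Let depth (i : 'I_n) (k : nat) (j : J) : R := crossed i (x i j) * scale k.

Let bound (k : nat) : nat := (2 * #|S| * (n * 2 ^ k))%N.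

Let bin (k : nat) (j : J) : {ffun 'I_n -> 'I_(bound k).+1} :=
  [ffun i => inord (Num.truncn (depth i k j))].

Let scale_gt0 k : 0 < scale k.
Proof. by rewrite mulr_gt0 ?ltr0n ?exprn_gt0. Qed.

Let passed_ge0 i y w : 0 <= passed i y w.
Proof. by apply: sumr_ge0 => s _; rewrite addr_ge0 ?ler0n. Qed.

Let crossed_ge0 i y : 0 <= crossed i y.
Proof. by apply: sumr_ge0 => w _; rewrite mulr_ge0. Qed.

Let depth_ge0 i k j : 0 <= depth i k j.
Proof. by rewrite mulr_ge0 ?crossed_ge0 // ltW. Qed.

Let crossed_le i y : crossed i y <= (2 * #|S|)%:R.
Proof.
rewrite -(mean_cst p_sum1 (2 * #|S|)%:R); apply: mean_le => // w.
rewrite mulnC natrM mulr_natl -sumr_const; apply: ler_sum => s _.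
by rewrite -natrD ler_nat; case: (_ < _); case: (_ <= _).
Qed.

Let bin_val k j i : bin k j i = Num.truncn (depth i k j) :> nat.
Proof.
rewrite ffunE inordK // ltnS -(ler_nat R).
have /andP[/le_trans -> //] := truncn_itv (depth_ge0 i k j).
rewrite /depth /bound natrM ler_pM ?crossed_ge0 ?crossed_le ?(ltW (scale_gt0 k)) //.
by rewrite natrM natrX.
Qed.

Let bin_nested k j j' : bin k.+1 j = bin k.+1 j' -> bin k j = bin k j'.
Proof.
move=> jj'; apply/ffunP => i; apply/val_inj; rewrite /= !bin_val.
have E l : depth i k l * 2 = depth i k.+1 l by rewrite /depth /scale exprSr !mulrA.
by rewrite (truncn_half (depth_ge0 i k j)) (truncn_half (depth_ge0 i k j')) !E -!bin_val jj'.
Qed.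

(* Both indicators are monotone in [y], so crossing a threshold increases [passed]. *)
Let split_le (i : 'I_n) (y z : R) : y <= z ->
  mean p (fun w => (~~ same_side i w y z)%:R) <= crossed i z - crossed i y.
Proof.
move=> yz; rewrite /crossed -meanN -meanD; apply: mean_le => // w.
rewrite /passed -sumrN -big_split /=.
have ge0 s : 0 <= (tau i s w < z)%R%:R + (tau i s w <= z)%R%:R -
    ((tau i s w < y)%R%:R + (tau i s w <= y)%R%:R) :> R.
  have l1 : (tau i s w < y) ==> (tau i s w < z).
    by apply/implyP => /lt_le_trans; apply.
  have l2 : (tau i s w <= y) ==> (tau i s w <= z).
    by apply/implyP => /le_trans; apply.
  rewrite subr_ge0 -!natrD ler_nat; move: l1 l2.
  by case: (tau i s w < y); case: (tau i s w < z); case: (tau i s w <= y); case: (tau i s w <= z).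
case: (boolP (same_side i w y z)) => /= [_|]; first exact: sumr_ge0.
rewrite negb_forall => /existsP[s hs].
rewrite (bigD1 s) //= -[leLHS]addr0 lerD ?sumr_ge0 //.
have l1 : (tau i s w < y) ==> (tau i s w < z).
  by apply/implyP => /lt_le_trans; apply.
have l2 : (tau i s w <= y) ==> (tau i s w <= z).
  by apply/implyP => /le_trans; apply.
rewrite lerBrDr -!natrD ler_nat; move: l1 l2 hs.
by case: (tau i s w < y); case: (tau i s w < z); case: (tau i s w <= y); case: (tau i s w <= z).
Qed.

(** Extreme members of the cell of [j] along axis [i]: thresholds that do not separate these two
    separate no members of the cell on that axis. *)
Let lo k i j : J := [arg min_(j' < j | bin k j' == bin k j) x i j']%O.
Let hi k i j : J := [arg max_(j' > j | bin k j' == bin k j) x i j']%O.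

Let loP k i j : bin k (lo k i j) = bin k j /\
  forall j', bin k j' = bin k j -> x i (lo k i j) <= x i j'.
Proof.
by rewrite /lo; case: arg_minP => // j1 /eqP -> h; split=> // j' /eqP /h.
Qed.

Let hiP k i j : bin k (hi k i j) = bin k j /\
  forall j', bin k j' = bin k j -> x i j' <= x i (hi k i j).
Proof.
by rewrite /hi; case: arg_maxP => // j1 /eqP -> h; split=> // j' /eqP /h.
Qed.

Let broken k j w : bool :=
  [exists i, ~~ same_side i w (x i (lo k i j)) (x i (hi k i j))].

(** On each axis [lo] and [hi] share a bin, so their depths differ by less than 1 and [split_le]
    gives 1 / [scale k]; summing over [n] axes leaves 2^-k. *)
Let mean_broken k j : mean p (fun w => (broken k j w)%:R) <= (2 ^+ k)^-1.
Proof.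
apply: (@le_trans _ _ (\sum_(i < n) mean p
    (fun w => (~~ same_side i w (x i (lo k i j)) (x i (hi k i j)))%:R))).
  rewrite -mean_sum; apply: mean_le => // w.
  case: (boolP (broken k j w)) => [/existsP[i hb]|_]; last exact: sumr_ge0.
  by rewrite (bigD1 i) //= hb lerDl sumr_ge0.
apply: (@le_trans _ _ (\sum_(i < n) (scale k)^-1)); last first.
  rewrite sumr_const card_ord -[leLHS]mulr_natl /scale invfM mulrA divff ?mul1r //.
  by rewrite pnatr_eq0 -lt0n.
apply: ler_sum => i _.
have [bl ml] := loP k i j; have [bh mh] := hiP k i j.
apply: (le_trans (split_le _ _)); first by rewrite (ml _ bh).
rewrite -[leRHS]mul1r ler_pdivlMr // mulrBl ltW //.
by apply: truncn_dist; rewrite ?depth_ge0 // -!bin_val bl bh.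
Qed.

Let unbroken_cst k j j' w : ~~ broken k j w -> bin k j' = bin k j -> f w j' = f w j.
Proof.
rewrite negb_exists => /forallP nb jj'; apply: f_same_side => i.
have /forallP ss := negPn (nb i).
have [bl ml] := loP k i j; have [bh mh] := hiP k i j.
have side j1 : bin k j1 = bin k j -> forall s,
   ((tau i s w < x i j1) = (tau i s w < x i (lo k i j))) /\
   ((tau i s w <= x i j1) = (tau i s w <= x i (lo k i j))).
  move=> /[dup]/ml l1 /mh l2 s; have /andP[/eqP e1 /eqP e2] := ss s.
  split; apply/idP/idP.
  - by rewrite e1 => /lt_le_trans; apply.
  - by move/lt_le_trans; apply.
  - by rewrite e2 => /le_trans; apply.
  - by move/le_trans; apply.
apply/forallP => s; have [-> ->] := side _ jj' s.
by have [-> ->] := side j erefl s; rewrite !eqxx.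
Qed.

(** The lower bracket. The default 1 is harmless, since losses are at most 1 and the cell contains
    [j]. *)
Let cell_min k j w : R := \big[Num.min/1]_(j' | bin k j' == bin k j) f w j'.

Let cell_min_le k j j' w : bin k j' = bin k j -> cell_min k j w <= f w j'.
Proof. by move=> jj'; apply: bigmin_le_cond; rewrite jj'. Qed.

Let le_cell_min k j w c : c <= 1 ->
  (forall j', bin k j' = bin k j -> c <= f w j') -> c <= cell_min k j w.
Proof. by move=> c1 h; apply: le_bigmin => // j' /eqP /h. Qed.

Let cell_min_ge0 k j w : 0 <= cell_min k j w.
Proof. by apply: le_cell_min => // j' _; have /andP[] := f01 w j'. Qed.

Let cell_min_le1 k j w : cell_min k j w <= 1.
Proof. by apply: (le_trans (cell_min_le w erefl)); have /andP[] := f01 w j. Qed.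

Let cell_min_nondecr k j w : cell_min k j w <= cell_min k.+1 j w.
Proof. by apply: le_cell_min => // j' /bin_nested; exact: cell_min_le. Qed.

Let cell_min_unbroken k j w : ~~ broken k j w -> cell_min k j w = f w j.
Proof.
move=> nb; apply/eqP; rewrite eq_le cell_min_le //=.
apply: le_cell_min; first by have /andP[] := f01 w j.
by move=> j' /(unbroken_cst nb) ->.
Qed.

Let incr k j w : R :=
  if k is k'.+1 then cell_min k j w - cell_min k' j w else cell_min 0 j w.

Let sum_incr k j w : \sum_(l < k.+1) incr l j w = cell_min k j w.
Proof.
elim: k => [|k IH]; first by rewrite big_ord_recr big_ord0 /= add0r.
by rewrite big_ord_recr IH /= addrCA subrr addr0.
Qed.

Let incr_ge0 k j w : 0 <= incr k j w.
Proof. by case: k => [|k] /=; rewrite ?subr_ge0. Qed.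

Let incr_bin k j j' w : bin k j = bin k j' -> incr k j w = incr k j' w.
Proof.
have E l : bin l j = bin l j' -> cell_min l j w = cell_min l j' w.
  by rewrite /cell_min => ->.
case: k => [|k] /=; first exact: E.
by move=> jj'; rewrite !E // ; exact: bin_nested.
Qed.

(** An increment lies in [0,1] and vanishes unless the coarser cell is broken, which has probability
    at most 2^-(k-1). At level 0 the bound 1 is enough. *)
Let mean_incr2 k j : mean p (fun w => incr k j w ^+ 2) <= 2 / 2 ^+ k.
Proof.
case: k => [|k].
  rewrite expr0 divr1 (@le_trans _ _ 1) ?ler1n // -(mean_cst p_sum1 1).
  apply: mean_le => // w; rewrite expr_le1 //=; exact: cell_min_le1.
rewrite exprS invfM mulrA divff ?mul1r //.
apply: le_trans (mean_broken k j); apply: mean_le => // w.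
case: (boolP (broken k j w)) => [_|nb] /=.
  rewrite expr_le1 ?subr_ge0 //.
  have := cell_min_ge0 k j w; have := cell_min_le1 k.+1 j w; lra.
have le : cell_min k.+1 j w <= cell_min k j w.
  by rewrite (cell_min_unbroken nb) cell_min_le.
by rewrite (_ : _ - _ = 0) ?expr0n //; have := cell_min_nondecr k j w; lra.
Qed.

Let mean_cell_min k j : mean p (f ^~ j) <= mean p (cell_min k j) + (2 ^+ k)^-1.
Proof.
apply: (@le_trans _ _ (mean p (fun w => cell_min k j w + (broken k j w)%:R))).
  apply: mean_le => // w; case: (boolP (broken k j w)) => [_|nb] /=.
    have := cell_min_ge0 k j w; have /andP[_] := f01 w j; lra.
  by rewrite (cell_min_unbroken nb) addr0.
by rewrite meanD lerD2l.
Qed.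

(** Both [n] and [#|S|] are at most 2^n, so each axis has at most 2^(2n+k+1) + 1 bins. *)
Let card_bin k : (#|{ffun 'I_n -> 'I_(bound k).+1}| <= 2 ^ (n * (2 * n + k + 2)))%N.
Proof.
rewrite card_ffun !card_ord mulnC expnM leq_exp2r //.
have n2 : (n <= 2 ^ n)%N by rewrite ltnW // ltn_expl.
have : (bound k <= 2 ^ (2 * n + k + 1))%N.
  have -> : (2 ^ (2 * n + k + 1) = 2 * 2 ^ n * (2 ^ n * 2 ^ k))%N.
    by rewrite addn1 expnS expnD [(2 * n)%N]mul2n -addnn expnD !mulnA.
  by rewrite /bound !leq_mul.
have : (0 < 2 ^ (2 * n + k + 1))%N by rewrite expn_gt0.
by rewrite !addnS !addn0 !expnS; lia.
Qed.

Variables (m : nat) (rho Lam : R).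
Hypothesis rho_gt0 : 0 < rho.
Hypothesis Lam_ge0 : 0 <= Lam.
Hypothesis m_large : 128 * 128 * (n%:R ^+ 2 + Lam) <= m%:R * rho ^+ 2.

(** The ratio 4/5 is small enough for the gaps to sum to at most rho / 2, and large enough that
    gap^2 2^k still grows, by 2 (4/5)^2 = 32/25 per level, which beats the linear growth of the
    entropy. *)
Let gap (k : nat) : R := rho / 10 * (4 / 5) ^+ k.

Let gap_ge0 k : 0 <= gap k.
Proof. by rewrite mulr_ge0 ?exprn_ge0 //; have := rho_gt0; lra. Qed.

Let sum_gap k : \sum_(l < k) gap l <= rho / 2.
Proof.
suff -> : \sum_(l < k) gap l = rho / 2 * (1 - (4 / 5) ^+ k).
  rewrite ler_piMr ?ltW ?divr_gt0 // gerBl exprn_ge0 //; lra.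
elim: k => [|k IH]; first by rewrite big_ord0 expr0 subrr mulr0.
by rewrite big_ord_recr IH /gap /= exprS; field.
Qed.

Let tail_level k :
  #|{ffun 'I_n -> 'I_(bound k).+1}|%:R *
    expR (- (m%:R * gap k ^+ 2 / (4 * (2 / 2 ^+ k)))) <= expR (- Lam) / 2 ^+ k.+1.
Proof.
have e2 : 2 <= expR 1 :> R by have := expR_ge1Dx (1 : R); lra.
have pow2 (l : nat) : 2 ^+ l <= expR l%:R :> R.
  by rewrite -[l%:R]mulr1 expRM_natl lerXn2r ?nnegrE ?expR_ge0.
apply: (@le_trans _ _ (expR (n * (2 * n + k + 2))%:R *
    expR (- (m%:R * gap k ^+ 2 / (4 * (2 / 2 ^+ k)))))).
  rewrite ler_wpM2r ?expR_ge0 //; apply: le_trans (pow2 _).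
  by rewrite -natrX ler_nat card_bin.
apply: (@le_trans _ _ (expR (- Lam) * expR (- (k.+1)%:R))); last first.
  by rewrite ler_wpM2l ?expR_ge0 // expRN lef_pV2 ?posrE ?expR_gt0 ?exprn_gt0.
rewrite -!expRD ler_expR.
have -> : m%:R * gap k ^+ 2 / (4 * (2 / 2 ^+ k)) =
    (m%:R * rho ^+ 2) / 800 * (32 / 25) ^+ k.
  have -> : (32 / 25) ^+ k = ((4 / 5) ^+ k) ^+ 2 * 2 ^+ k :> R.
    by rewrite -exprM mulnC exprM -exprMn; congr (_ ^+ _); field.
  have : 2 ^+ k != 0 :> R by rewrite expf_neq0.
  by rewrite /gap; move: (2 ^+ k) ((4 / 5) ^+ k) => u v u0; field.
(* Each factor 32/25 adds at least 7/25, hence at least 1/4, because the power is at least 1. *)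
have bern : (k.+1)%:R / 4 <= (32 / 25) ^+ k :> R.
  elim: (k) => [|l IH]; first by rewrite expr0; lra.
  rewrite exprS -[l.+2%:R]natr1; move: IH.
  set A := _ ^+ l; have : 1 <= A by rewrite exprn_ege1 //; lra.
  by lra.
have n1 : 1 <= n%:R :> R by rewrite ler1n.
have k0 : 0 <= k%:R :> R by [].
(* The left side dominates the total cost n(2n+k+2) + (k+1) + Lam: cell count, level weight and
   confidence. The constants fit since 20 * 800 <= 128 * 128. *)
have big : 5 * (k.+1)%:R * (n%:R ^+ 2 + Lam) <= m%:R * rho ^+ 2 / 800 * (32 / 25) ^+ k.
  rewrite -natr1 in bern *.
  set M := m%:R * rho ^+ 2 / 800; set Y := n%:R ^+ 2 + Lam.
  have Y0 : 0 <= 20 * Y by rewrite mulr_ge0 // addr_ge0 // exprn_ge0.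
  have YM : 20 * Y <= M by rewrite /M; have : 128 * 128 * Y <= m%:R * rho ^+ 2 := m_large; move: Y0; lra.
  have k40 : 0 <= (k%:R + 1) / 4 :> R by lra.
  have -> : 5 * (k%:R + 1) * Y = 20 * Y * ((k%:R + 1) / 4) by field.
  exact: ler_pM.
rewrite -natr1 in big; rewrite natrM (natrD _ _ 2) (natrD _ _ k) (natrM _ 2) -natr1.
have nn : n%:R <= n%:R ^+ 2 :> R by rewrite expr2 ler_peMr.
have nnk : n%:R * k%:R <= n%:R ^+ 2 * k%:R :> R by rewrite ler_wpM2r.
have kn : k%:R <= n%:R ^+ 2 * k%:R :> R by rewrite ler_peMl // exprn_ege1.
have lk : 0 <= Lam * k%:R by rewrite mulr_ge0.
have n21 : 1 <= n%:R ^+ 2 :> R by rewrite exprn_ege1.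
move: (_ / 800 * _) big => M big; have := Lam_ge0; nra.
Qed.

Lemma chaining_tail :
  iid_pr p [pred ws : {ffun 'I_m -> W} |
     [exists j, \sum_(k < m) f (ws k) j < m%:R * (mean p (f ^~ j) - rho)]]
  <= expR (- Lam).
Proof.
(* Half of [rho] covers stopping the chain at level [K]; the gaps use up the other half. *)
have [K hK] : exists K, (2 ^+ K)^-1 <= rho / 2 :> R.
  exists (Num.truncn (2 / rho)).+1.
  have h : 2 / rho < (Num.truncn (2 / rho)).+1%:R.
    by have /andP[] := truncn_itv (ltW (divr_gt0 (ltr0Sn R 1) rho_gt0)).
  rewrite -[rho / 2]invf_div lef_pV2 ?posrE ?exprn_gt0 ?divr_gt0 //.
  apply: (le_trans (ltW h)); rewrite -natrX ler_nat ltnW // ltn_expl //.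
pose bad (k : 'I_K.+1) j := [pred ws : {ffun 'I_m -> W} |
  \sum_(l < m) incr k j (ws l) <= m%:R * (mean p (incr k j) - gap k)].
apply: (@le_trans _ _ (iid_pr p [pred ws | [exists k, [exists j, bad k j ws]]])).
  apply: iid_pr_le => // ws /=; apply: contraTT => /existsPn nb.
  apply/existsPn => j; rewrite -leNgt.
  have {}nb (k : 'I_K.+1) : m%:R * (mean p (incr k j) - gap k) <=
      \sum_(l < m) incr k j (ws l).
    by have /existsPn/(_ j) := nb k; rewrite /= -ltNge => /ltW.
  (* The empirical loss dominates that of the bracket at level [K], which telescopes into the
     increments. *)
  apply: (@le_trans _ _ (\sum_(l < m) cell_min K j (ws l))); last first.
    by apply: ler_sum => l _; exact: cell_min_le.
  have -> : \sum_(l < m) cell_min K j (ws l) =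
      \sum_(k < K.+1) \sum_(l < m) incr k j (ws l).
    by rewrite exchange_big; apply: eq_bigr => l _; rewrite sum_incr.
  apply: (le_trans _ (ler_sum _ (fun k _ => nb k))).
  rewrite -mulr_sumr ler_wpM2l // big_split /= sumrN -mean_sum.
  have -> : mean p (fun w => \sum_(k < K.+1) incr k j w) = mean p (cell_min K j).
    by apply: eq_bigr => w _; rewrite sum_incr.
  have := mean_cell_min K j; have := sum_gap K.+1; move: hK; lra.
apply: (le_trans (iid_pr_exists _ _)) => //.
apply: (@le_trans _ _ (\sum_(k < K.+1) expR (- Lam) / 2 ^+ k.+1)).
  apply: ler_sum => k _; apply: le_trans (tail_level k).
  (* Increments of level [k] depend on [j] only through its bin, so the union runs over cells. *)
  apply: (@iid_pr_exists_class _ _ _ p_ge0 _ _ (bin k)); first exact: expR_ge0.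
    move=> j j' ws jj'; rewrite /bad /= /mean; congr (_ <= _ * (_ - _)).
      by apply: eq_bigr => l _; exact: incr_bin.
    by apply: eq_bigr => w _; rewrite (incr_bin _ jj').
  by move=> j; apply: iid_pr_lower_tail => //; rewrite divr_gt0 ?exprn_gt0.
rewrite -mulr_sumr ler_piMr ?expR_ge0 //.
suff -> : \sum_(k < K.+1) (2 ^+ k.+1)^-1 = 1 - (2 ^+ K.+1)^-1 :> R.
  by rewrite gerBl invr_ge0 exprn_ge0.
elim: (K.+1) => [|k IH]; first by rewrite big_ord0 expr0 invr1 subrr.
by rewrite big_ord_recr IH /= exprS invfM; field; rewrite expf_neq0.
Qed.

End Chaining.

(** * Reduction of an i.i.d. sample to a finite probability space *)

Lemma measure_bigsetU_le (d : measure_display) (T : measurableType d)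
    (R : realType) (mu : {measure set T -> \bar R}) (I : finType) (A : pred I)
    (B : I -> set T) : (forall i, measurable (B i)) ->
  (mu (\big[setU/set0]_(i | A i) B i) <= \sum_(i | A i) mu (B i))%E.
Proof.
move=> mB.
suff [] : measurable (\big[setU/set0]_(i | A i) B i) /\
  (mu (\big[setU/set0]_(i | A i) B i) <= \sum_(i | A i) mu (B i))%E by [].
elim/big_ind2 : _ => [|U x V y [mU Ux] [mV Vy]|i _] //.
  by rewrite measure0.
split; first exact: measurableU.
by apply: (le_trans (measureU2 _ _ _)) => //; exact: leeD.
Qed.

Section FiniteValued.
Context (R : realType) (d : measure_display) (T : measurableType d).
Variables (P : probability T R) (W : finType) (Phi : T -> W).
Hypothesis mPhi : forall w, measurable (Phi @^-1` [set w]).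

Definition law (w : W) : R := fine (P (Phi @^-1` [set w])).

Lemma lawE w : (law w)%:E = P (Phi @^-1` [set w]).
Proof. by rewrite fineK // fin_num_measure. Qed.

Lemma law_ge0 w : 0 <= law w.
Proof. by rewrite fine_ge0. Qed.

Lemma integral_finite_valued (g : W -> R) : (forall w, 0 <= g w) ->
  (\int[P]_t (g (Phi t))%:E)%E = (mean law g)%:E.
Proof.
move=> g0; pose A w := Phi @^-1` [set w].
rewrite (eq_integral (fun t => \sum_w (g w)%:E * (\1_(A w) t)%:E)%E); last first.
  move=> t _; rewrite (bigD1 (Phi t)) //= big1 => [|w wt].
    by rewrite indicE mem_set // mule1 adde0.
  by rewrite indicE memNset ?mule0 // => /eqP; rewrite eq_sym (negbTE wt).
rewrite ge0_integral_sum //; last 2 first.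
- move=> w; apply: measurable_funeM; apply/measurable_EFinP; exact: measurable_indic (mPhi w).
- by move=> w t _; rewrite mule_ge0 ?lee_fin.
rewrite /mean -sumEFin; apply: eq_bigr => w _.
rewrite ge0_integralZl ?lee_fin //; last first.
  by apply/measurable_EFinP; exact: (measurable_indic (mPhi w)).
by rewrite EFinM lawE muleC /A integral_indic // setIT.
Qed.

Lemma measurable_finite_valued (g : W -> R) :
  measurable_fun setT (fun t => g (Phi t)).
Proof.
move=> _ Y mY; rewrite setTI.
have -> : (fun t => g (Phi t)) @^-1` Y =
    \big[setU/set0]_(w | `[< Y (g w) >]) (Phi @^-1` [set w]).
  rewrite -bigcup_seq_cond; apply/seteqP; split=> t /=.
    by move=> Yt; exists (Phi t) => //=; rewrite mem_index_enum; exact/asboolP.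
  by case=> w /= /andP[_ /asboolP Yw] ->.
by apply: bigsetU_measurable => w _.
Qed.

Lemma law_sum1 : \sum_w law w = 1.
Proof.
apply: EFin_inj; rewrite -(_ : mean law (fun=> 1) = \sum_w law w); last first.
  by apply: eq_bigr => w _; rewrite mulr1.
rewrite -integral_finite_valued // integral_cst // mul1e; exact: probability_setT.
Qed.

Context (d' : measure_display) (Omega : measurableType d').
Variables (Q : probability Omega R) (m : nat) (X : 'I_m -> Omega -> T).
Hypothesis iidX : iid_sample P Q X.

(** The event is covered by the finitely many product cells on which the rounded sample satisfies
    [A], and the i.i.d. hypothesis makes each cell's probability a product. *)
Lemma iid_sample_le (A : pred {ffun 'I_m -> W}) (B : set Omega) :
    measurable B -> (forall om, B om -> A [ffun k => Phi (X k om)]) ->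
  (Q B <= (iid_pr law A)%:E)%E.
Proof.
move=> mB BA; case: iidX => mX iid.
pose C (ws : {ffun 'I_m -> W}) :=
  \big[setI/setT]_(k < m) (X k @^-1` (Phi @^-1` [set ws k])).
have mC ws : measurable (C ws).
  by apply: bigsetI_measurable => k _; rewrite -[X in measurable X]setTI; exact: mX.
apply: (@le_trans _ _ (Q (\big[setU/set0]_(ws | A ws) C ws))).
  apply: le_measure; rewrite ?inE //; first exact: bigsetU_measurable.
  move=> om Bom; rewrite -bigcup_seq_cond.
  exists [ffun k => Phi (X k om)].
    by rewrite /= mem_index_enum BA.
  rewrite /C -bigcap_seq => k _ /=; by rewrite ffunE.
apply: (le_trans (measure_bigsetU_le _ _ mC)).
rewrite /iid_pr -sumEFin; apply: lee_sum => ws _.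
suff e : Q (C ws) = (\prod_(k < m) law (ws k))%:E.
  by rewrite le_eqVlt; apply/orP; left; apply/eqP; exact: e.
rewrite /C (iid (fun k => Phi @^-1` [set ws k])) // -prodEFin.
by apply: eq_bigr => k _; rewrite lawE.
Qed.

End FiniteValued.

(** * One-sided uniform bound over finitely, then countably many vectors *)

Section Transfer.
Context (R : realType) (d : measure_display) (T : measurableType d).
Variables (P : probability T R) (n : nat) (S : finType).
Hypothesis n_gt0 : (0 < n)%N.
Hypothesis cardS : (#|S| <= 2 ^ n)%N.
Variables (tau : T -> 'I_n -> S -> R) (F : T -> ('I_n -> R) -> R).
Hypothesis F01 : forall t sigma, 0 <= F t sigma <= 1.
Hypothesis mF : forall sigma, measurable_fun setT (F ^~ sigma).
Hypothesis F_same_side : forall t sigma sigma',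
  (forall i s, (tau t i s < sigma i) = (tau t i s < sigma' i) /\
               (tau t i s <= sigma i) = (tau t i s <= sigma' i)) ->
  F t sigma = F t sigma'.
Context (d' : measure_display) (Omega : measurableType d').
Variables (Q : probability Omega R) (m : nat) (X : 'I_m -> Omega -> T).
Hypothesis iidX : iid_sample P Q X.
Variables (rho Lam : R).
Hypothesis rho_gt0 : 0 < rho.
Hypothesis Lam_ge0 : 0 <= Lam.
Hypothesis m_large : 256 * 256 * (n%:R ^+ 2 + Lam) <= m%:R * rho ^+ 2.

Definition underestimated (sigma : 'I_n -> R) : set Omega :=
  [set om | \sum_(k < m) F (X k om) sigma <
            m%:R * (fine (\int[P]_t (F t sigma)%:E)%E - rho)].

Lemma measurable_underestimated sigma : measurable (underestimated sigma).
Proof.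
rewrite -[underestimated sigma]setTI.
have : measurable_fun setT (fun om => \sum_(k < m) F (X k om) sigma <
            m%:R * (fine (\int[P]_t (F t sigma)%:E)%E - rho)).
  apply: measurable_fun_ltr => //; apply: measurable_sum => k.
  apply: (measurableT_comp (mF sigma)); exact: (proj1 iidX).
by move=> /(_ measurableT [set true]) /=; apply.
Qed.

Lemma finite_underestimated (N : nat) (pt : 'I_N -> 'I_n -> R) :
  (Q (\big[setU/set0]_(j < N) underestimated (pt j)) <= (expR (- Lam))%:E)%E.
Proof.
(* Losses are rounded down to multiples of 1/V, an error of at most rho / 2. *)
pose V := (Num.truncn (2 / rho)).+1.
have V_gt0 : 0 < V%:R :> R by rewrite ltr0n.
have Vrho : V%:R^-1 <= rho / 2.
  rewrite -[rho / 2]invf_div lef_pV2 ?posrE ?divr_gt0 // ltW //.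
  by have /andP[] := truncn_itv (ltW (divr_gt0 (ltr0Sn R 1) rho_gt0)).
have FV_ge0 t sigma : 0 <= F t sigma * V%:R.
  by apply: mulr_ge0 => //; have /andP[] := F01 t sigma.
pose Phi t : {ffun 'I_N -> 'I_V.+1} := [ffun j => inord (Num.truncn (F t (pt j) * V%:R))].
have PhiE t j : Phi t j = Num.truncn (F t (pt j) * V%:R) :> nat.
  rewrite ffunE inordK // ltnS -(ler_nat R).
  have /andP[/le_trans -> //] := truncn_itv (FV_ge0 t (pt j)).
  by rewrite ler_piMl //; have /andP[] := F01 t (pt j).
have Phi_eq t w : (Phi t = w) <-> (forall j, (w j)%:R <= F t (pt j) * V%:R < (w j).+1%:R).
  split=> [<- j|h]; first by rewrite PhiE truncn_itv.
  apply/ffunP => j; apply/val_inj; rewrite /= PhiE; exact: truncn_def.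
have mPhi w : measurable (Phi @^-1` [set w]).
  have -> : Phi @^-1` [set w] = \big[setI/setT]_(j < N)
      ((fun t => F t (pt j) * V%:R) @^-1` `[(w j)%:R, (w j).+1%:R[%classic).
    rewrite -bigcap_seq; apply/seteqP; split=> t /= => [/Phi_eq h j _|h].
      by rewrite /= in_itv /= h.
    by apply/Phi_eq => j; have := h j; rewrite /= in_itv /=; apply; exact: mem_index_enum.
  apply: bigsetI_measurable => j _; rewrite -[X in measurable X]setTI.
  by apply: measurable_funM => //; exact: measurable_itv.
(* Loss and thresholds on the finite space are both read off a representative, so [F_same_side]
   applies to every [w], including values that [Phi] never takes. *)
pose rep w : T := xget point [set t | Phi t = w].
have repK t : Phi (rep (Phi t)) = Phi t.
  by apply: (@xgetPex _ point [set t' | Phi t' = Phi t]); exists t.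
pose f w j : R := (Phi (rep w) j)%:R / V%:R.
have fle t j : f (Phi t) j <= F t (pt j) <= f (Phi t) j + V%:R^-1.
  rewrite /f repK PhiE; have /andP[h1 h2] := truncn_itv (FV_ge0 t (pt j)).
  rewrite ler_pdivrMr // h1 /= -[X in _ + X]mul1r -mulrDl ler_pdivlMr //.
  by rewrite natr1 ltW.
have f01 w j : 0 <= f w j <= 1.
  rewrite /f divr_ge0 //= ler_pdivrMr // mul1r ler_nat.
  by rewrite -ltnS.
have p0 := law_ge0 P Phi; have p1 := law_sum1 P mPhi.
have f_ss w j j' : (forall i, same_side (fun i s w => tau (rep w) i s) i w (pt j i) (pt j' i)) ->
    f w j = f w j'.
  move=> h; rewrite /f !PhiE (@F_same_side _ _ (pt j')) // => i s.
  by have /forallP/(_ s)/andP[/eqP -> /eqP ->] := h i.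
(* Chaining runs at accuracy rho / 2, which costs the factor 4 between 128^2 and 256^2. *)
have m16 : 128 * 128 * (n%:R ^+ 2 + Lam) <= m%:R * (rho / 2) ^+ 2.
  by move: m_large; rewrite expr_div_n; move: (n%:R ^+ 2) => u; lra.
have rho2 : 0 < rho / 2 by rewrite divr_gt0.
have := chaining_tail p0 p1 n_gt0 cardS f01 (x := fun i j => pt j i) f_ss rho2 Lam_ge0 m16.
rewrite -lee_fin; apply: le_trans; apply: (iid_sample_le mPhi iidX).
  by apply: bigsetU_measurable => j _; exact: measurable_underestimated.
move=> om; rewrite -bigcup_seq => -[j _] /= bad.
apply/existsP; exists j.
(* Rounding down only lowers the empirical sum, and it lowers the mean by at most 1/V, so the bad
   event survives with rho / 2. *)
apply: (@le_lt_trans _ _ (\sum_(k < m) F (X k om) (pt j))).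
  apply: ler_sum => k _; rewrite ffunE.
  by have /andP[] := fle (X k om) j.
apply: (lt_le_trans bad); rewrite ler_wpM2l //.
suff : fine (\int[P]_t (F t (pt j))%:E)%E <= mean (law P Phi) (f ^~ j) + V%:R^-1.
  by move: Vrho; lra.
rewrite -(mean_cst p1 V%:R^-1) -meanD -lee_fin -integral_finite_valued //; last first.
  by move=> w; apply: addr_ge0; [have /andP[] := f01 w j|rewrite invr_ge0].
rewrite fineK; last first.
  rewrite ge0_fin_numE; last by apply: integral_ge0 => t _; rewrite lee_fin; have /andP[] := F01 t (pt j).
  apply: (@le_lt_trans _ _ (\int[P]_t (cst 1%E t))%E); last first.
    rewrite integral_cst // mul1e; have := probability_setT P; rewrite /= => ->; exact: ltry.
  apply: ge0_le_integral => //.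
  - by move=> t _; rewrite lee_fin; have /andP[] := F01 t (pt j).
  - exact/measurable_EFinP.
  - by move=> t _; rewrite lee_fin; have /andP[] := F01 t (pt j).
apply: ge0_le_integral => //.
- by move=> t _; rewrite lee_fin; have /andP[] := F01 t (pt j).
- exact/measurable_EFinP.
- by apply/measurable_EFinP; exact: (measurable_finite_valued mPhi (fun w => f w j + V%:R^-1)).
- by move=> t _; rewrite lee_fin; have /andP[] := fle t j.
Qed.

(** The finite bound does not depend on the number of vectors, so continuity from below passes it to
    the countable union. *)
Lemma bigcup_underestimated (pt : nat -> 'I_n -> R) :
  (Q (\bigcup_k underestimated (pt k)) <= (expR (- Lam))%:E)%E.
Proof.
pose U k := \big[setU/set0]_(j < k.+1) underestimated (pt j).
have mU k : measurable (U k).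
  by apply: bigsetU_measurable => j _; exact: measurable_underestimated.
rewrite -bigcup_bigsetU_bigcup.
have mUU : measurable (\bigcup_k U k) by exact: bigcup_measurable.
have ndU : nondecreasing_seq U.
  by move=> k l kl; apply/subsetPset; exact: (@subset_bigsetU _ (fun j => underestimated (pt j)) k.+1 l.+1).
have cvgU := @nondecreasing_cvg_mu _ _ _ Q _ mU mUU ndU.
rewrite -(cvg_lim _ cvgU) //; apply: lime_le; first by apply/cvg_ex; exists (Q (\bigcup_k U k)).
by near=> k; exact: (finite_underestimated (fun j : 'I_k.+1 => pt j)).
Unshelve. all: by end_near. Qed.

End Transfer.

(** * Equilibria through thresholds; bounds and semicontinuity of the loss *)

Section Game.
Variables (R : realType) (n : nat).
Implicit Types (G : cmgame R n) (sigma : 'I_n -> R) (s : profile n).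

(* The subsidy at which agent [i] is indifferent between repairing or not,
   when the others play according to [s]. *)
Definition threshold G (i : 'I_n) s : R :=
  cost G i - (if s i then exp_phi G s - exp_phi G (deviate s i false)
              else exp_phi G (deviate s i true) - exp_phi G s).

Lemma deviate_id s i : deviate s i (s i) = s.
Proof. by apply/ffunP => j; rewrite ffunE; case: eqP => // ->. Qed.

(** Only switching to the opposite action matters, and that comparison is affine in [sigma i]. The
    negated strict inequality matches the comparisons used in [same_side]. *)
Lemma pure_NE_threshold G sigma s :
  is_pure_NE G sigma s =
  [forall i, if s i then threshold G i s <= sigma i
             else ~~ (threshold G i s < sigma i)].
Proof.
apply: eq_forallb => i; rewrite -leNgt /threshold.
have dev b : deviate s i b i = b by rewrite ffunE eqxx.
have := deviate_id s i; case: (boolP (s i)) => si sE;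
  apply/forallP/idP => [|h b].
- move=> /(_ false); rewrite /subs_cost_i /agent_cost /subs_i dev si /=; lra.
- rewrite /subs_cost_i /agent_cost /subs_i dev si; case: b => /=; first by rewrite sE.
  by move: h; lra.
- move=> /(_ true); rewrite /subs_cost_i /agent_cost /subs_i dev (negbTE si) /=; lra.
- rewrite /subs_cost_i /agent_cost /subs_i dev (negbTE si); case: b => /=; last by rewrite sE.
  by move: h; lra.
Qed.

(** Subsidies cancel, so [sigma] affects the loss only through the set of equilibria. *)
Lemma social_costE G sigma s :
  cost_sigma G sigma s + subs_total sigma s = \sum_(i < n) agent_cost G i s.
Proof.
rewrite /cost_sigma /subs_total -big_split /=; apply: eq_bigr => i _.
by rewrite /subs_cost_i subrK.
Qed.

Lemma loss_prior_same_side G sigma sigma' :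
    (forall i s, (threshold G i s < sigma i) = (threshold G i s < sigma' i) /\
                 (threshold G i s <= sigma i) = (threshold G i s <= sigma' i)) ->
  loss_prior G sigma = loss_prior G sigma'.
Proof.
move=> h; rewrite /loss_prior; apply: eq_big => [s|s _]; last by rewrite !social_costE.
rewrite !pure_NE_threshold; apply: eq_forallb => i.
by have [-> ->] := h i s.
Qed.

Lemma loss_prior_ge0 G sigma : 0 <= loss_prior G sigma.
Proof. exact: bigmax_ge_id. Qed.

Lemma exp_phi_ge0 H G s : valid_game H G -> 0 <= exp_phi G s.
Proof.
move=> [th _]; apply: sumr_ge0 => x _; rewrite mulr_ge0 //.
by apply: prodr_ge0 => i _; have /andP[] := th i; case: (x i) => //; lra.
Qed.

(** Each agent costs at most H + 1, which is at most 2H because [1 <= H]. *)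
Lemma loss_prior_le H G sigma : 1 <= H -> valid_game H G ->
  loss_prior G sigma <= 2 * n%:R * H.
Proof.
move=> H1 vG; have H0 : 0 <= H by lra.
apply: bigmax_le; first by rewrite !mulr_ge0.
move=> s _; rewrite social_costE.
rewrite [2 * _]mulrC -mulrA mulr_natl -[n in leRHS]card_ord -sumr_const.
apply: ler_sum => i _; rewrite /agent_cost.
have := exp_phi_ge0 s vG; have /andP[] := proj2 vG i.
by case: (s i) => /=; lra.
Qed.

(* Upper semicontinuity: strict preferences persist, so equilibria can only
   disappear under a small perturbation of the subsidies. *)
Lemma loss_prior_usc (m : nat) (S : 'I_m -> cmgame R n) sigma :
  exists2 r, 0 < r & forall sigma', (forall i, `|sigma' i - sigma i| < r) ->
    forall k, loss_prior (S k) sigma' <= loss_prior (S k) sigma.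
Proof.
pose D (q : 'I_m * 'I_n * profile n) := threshold (S q.1.1) q.1.2 q.2 - sigma q.1.2.
(* The radius is the least nonzero distance from [sigma] to a threshold, capped at 1. *)
exists (\big[Num.min/1]_(q | D q != 0) `|D q|).
  by apply: lt_bigmin => // q; rewrite normr_gt0.
move=> sigma' near k; rewrite /loss_prior.
under eq_bigr do rewrite social_costE.
under [leRHS]eq_bigr do rewrite social_costE.
apply: sub_bigmax => s; rewrite !pure_NE_threshold => /forallP NE.
apply/forallP => i; have := NE i; have := near i.
set r := \big[_/_]_(_ | _) _; set t := threshold _ _ _ => nr.
(* At a tie both actions are best responses under [sigma]; otherwise [sigma'] lies strictly on the
   same side of the threshold. *)
have [D0|D0] := eqVneq (D (k, i, s)) 0.
  have -> : t = sigma i by move/eqP: D0; rewrite subr_eq0 => /eqP.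
  by rewrite lexx ltxx; case: ifP.
have rD : r <= `|t - sigma i| by apply: (bigmin_le_cond _ (j := (k, i, s))).
have := lt_le_trans nr rD.
rewrite ltr_norml => /andP[]; case: (ger0P (t - sigma i)) => b0 a1 a2;
  by case: (s i); rewrite -?leNgt => h; lra.
Qed.

End Game.

(* One point is chosen per rational box and rational level. *)
Lemma countable_superlevel_dense (R : realType) (n : nat) (M : ('I_n -> R) -> R) :
  exists pt : nat -> 'I_n -> R, forall sigma r eta, 0 < r -> 0 < eta ->
    exists k, (forall i, `|pt k i - sigma i| < r) /\ M sigma - eta < M (pt k).
Proof.
pose K : countType := ({ffun 'I_n -> rat * rat} * rat)%type.
pose A (q : K) (sigma : 'I_n -> R) :=
  (forall i, ratr (q.1 i).1 < sigma i < ratr (q.1 i).2) /\ ratr q.2 < M sigma.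
have /choice[c cP] : forall q, exists sigma, (exists sigma', A q sigma') -> A q sigma.
  move=> q; have [[sigma h]|nh] := pselect (exists sigma', A q sigma').
    by exists sigma.
  by exists (fun=> 0).
exists (fun k => if unpickle k is Some q then c q else fun=> 0) => sigma r eta r0 eta0.
have /choice[u uP] : forall i, exists x : rat * rat,
    [/\ sigma i - r < ratr x.1, ratr x.1 < sigma i, sigma i < ratr x.2 &
        ratr x.2 < sigma i + r].
  move=> i.
  have [a] := @rat_in_itvoo R (sigma i - r) (sigma i) ltac:(lra).
  have [b] := @rat_in_itvoo R (sigma i) (sigma i + r) ltac:(lra).
  by rewrite !in_itv /= => /andP[b1 b2] /andP[a1 a2]; exists (a, b).
have [l] := @rat_in_itvoo R (M sigma - eta) (M sigma) ltac:(lra).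
rewrite in_itv /= => /andP[l1 l2].
pose q : K := ([ffun i => u i], l).
have [] : A q (c q).
  apply: cP; exists sigma; split=> // i; rewrite ffunE.
  by have [_ -> -> _] := uP i.
move=> box lev; exists (pickle q); rewrite pickleK; split; last exact: lt_trans lev.
move=> i; have := box i; rewrite ffunE => /andP[]; have [] := uP i.
by rewrite ltr_distl; lra.
Qed.

(** Provides the fixed, nearly optimal vector against which the empirical minimizer is compared. *)
Lemma near_inf (R : realType) (U : Type) (A : set U) (M : U -> R) (eps : R) :
    0 < eps -> A !=set0 -> (forall u, 0 <= M u) ->
  exists2 u, A u & forall v, A v -> M u <= M v + eps.
Proof.
move=> eps0 [u0 Au0] M0.
have lb : has_lbound (M @` A) by exists 0 => _ [u _ <-].
have [|_ [u Au <-] uinf] := @inf_adherent _ (M @` A) _ eps0.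
  by split => //; exists (M u0), u0.
exists u => // v Av; apply: (le_trans (ltW uinf)); rewrite lerD2r.
by apply: ge_inf => //; exists v.
Qed.

(** * Generalization of the empirical minimizer *)

Section Learning.
Context (R : realType) (n : nat) (H : R) (d : measure_display) (T : measurableType d).
Variables (P : probability T R) (G : T -> cmgame R n).
Hypothesis H_ge1 : 1 <= H.
Hypothesis n_gt0 : (0 < n)%N.
Hypothesis vG : forall t, valid_game H (G t).
Hypothesis mG : forall sigma, measurable_fun setT (fun t => loss_prior (G t) sigma).

Definition risk (sigma : 'I_n -> R) : R :=
  fine (\int[P]_t (loss_prior (G t) sigma)%:E)%E.

Let B : R := 2 * n%:R * H.

Let B_gt0 : 0 < B.
Proof. by rewrite !mulr_gt0 ?ltr0n //; have := H_ge1; lra. Qed.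

Let loss01 t sigma : 0 <= loss_prior (G t) sigma / B <= 1.
Proof.
rewrite divr_ge0 ?loss_prior_ge0 ?(ltW B_gt0) //=.
by rewrite ler_pdivrMr // mul1r loss_prior_le.
Qed.

Lemma integrable_loss sigma :
  P.-integrable setT (EFin \o (fun t => loss_prior (G t) sigma)).
Proof.
apply: measurable_bounded_integrable => //.
  by rewrite (le_lt_trans (probability_le1 P _)) ?ltry.
exists B; split; first exact: num_real.
move=> x Bx t _ /=; rewrite ger0_norm ?loss_prior_ge0 //.
by apply: le_trans (ltW Bx); exact: loss_prior_le.
Qed.

Lemma riskE sigma : (\int[P]_t (loss_prior (G t) sigma)%:E)%E = (risk sigma)%:E.
Proof.
rewrite /risk fineK //; exact: (integrable_fin_num measurableT (integrable_loss sigma)).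
Qed.

Lemma risk_ge0 sigma : 0 <= risk sigma.
Proof.
by apply: fine_ge0; apply: integral_ge0 => t _; rewrite lee_fin loss_prior_ge0.
Qed.

Let scaled_risk sigma :
  fine (\int[P]_t (loss_prior (G t) sigma / B)%:E)%E = risk sigma / B.
Proof.
have := RintegralZl B^-1 measurableT (integrable_loss sigma).
rewrite /Rintegral -/(risk sigma) mulrC => <-.
by congr fine; apply: eq_integral => t _; rewrite mulrC.
Qed.

(** Overestimating a loss is underestimating the complementary gain, so the same one-sided bound
    serves both directions. *)
Let scaled_gain sigma :
  fine (\int[P]_t (1 - loss_prior (G t) sigma / B)%:E)%E = 1 - risk sigma / B.
Proof.
have i1 := finite_measure_integrable_cst P 1 measurableT.
have i2 : P.-integrable setT (EFin \o (fun t => loss_prior (G t) sigma / B)).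
  apply: measurable_bounded_integrable => //.
  - by rewrite (le_lt_trans (probability_le1 P _)) ?ltry.
  - exact: measurable_funM.
  - exists 1; split; first exact: num_real.
    move=> x x1 t _ /=; have /andP[l0 l1] := loss01 t sigma.
    by rewrite ger0_norm //; apply: (le_trans l1); exact: ltW.
have := RintegralB measurableT i1 i2.
have -> : Rintegral P setT (cst 1) = 1.
  by rewrite Rintegral_cst // mul1r; exact: (congr1 fine (probability_setT P)).
by rewrite -scaled_risk => <-.
Qed.

Context (d' : measure_display) (Omega : measurableType d').
Variables (Q : probability Omega R) (m : nat) (X : 'I_m -> Omega -> T).
Hypothesis iidX : iid_sample P Q X.
Variables (eps delta : R).
Hypothesis eps_gt0 : 0 < eps.
Hypothesis delta_gt0 : 0 < delta.
Hypothesis delta_lt1 : delta < 1.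
Hypothesis m_large : 256 * 256 * 128 * ((n%:R ^+ 2 * H ^+ 2) / eps ^+ 2) *
  (n%:R ^+ 2 + ln delta^-1) <= m%:R.

Let emp omega := emp_loss (fun j => G (X j omega)).

Lemma erm_generalizes : exists E : set Omega,
  measurable E /\ ((1 - delta)%:E <= Q E)%E /\
  forall omega, E omega -> forall sighat, subsidy_scheme H sighat ->
    (forall sigma, subsidy_scheme H sigma -> emp omega sighat <= emp omega sigma) ->
    forall sigma, subsidy_scheme H sigma -> risk sighat <= risk sigma + eps.
Proof.
(* On the original scale [rho] amounts to eps / 4. The extra 1 in [Lam] bounds each of two bad
   events by delta / e, at most delta / 2. *)
pose rho := eps / (4 * B); pose Lam := ln delta^-1 + 1.
have L0 : 0 < ln delta^-1 by rewrite ln_gt0 // invf_gt1.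
have n1 : 1 <= n%:R ^+ 2 :> R by rewrite exprn_ege1 // ler1n.
have rho0 : 0 < rho by rewrite divr_gt0 // mulr_gt0.
have Lam0 : 0 <= Lam by rewrite /Lam; lra.
(* Here rho^2 = eps^2 / (64 n^2 H^2), and the extra 1 at most doubles n^2 + ln(1/delta), as
   [n >= 1]; hence 128 = 64 * 2. *)
have m_rho : 256 * 256 * (n%:R ^+ 2 + Lam) <= m%:R * rho ^+ 2.
  have nH : 0 < n%:R ^+ 2 * H ^+ 2.
    by rewrite mulr_gt0 ?exprn_gt0 ?ltr0n //; have := H_ge1; lra.
  have e2 : 0 < eps ^+ 2 by rewrite exprn_gt0.
  have -> : rho ^+ 2 = ((n%:R ^+ 2 * H ^+ 2) / eps ^+ 2)^-1 / 64.
    rewrite /rho /B; field.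
    have Hn0 : H != 0 by rewrite gt_eqF //; have := H_ge1; lra.
    by rewrite Hn0 pnatr_eq0 -lt0n n_gt0 (gt_eqF eps_gt0).
  move: m_large; set K := _ / eps ^+ 2.
  have K0 : 0 < K by rewrite divr_gt0.
  have K64 : 0 < K * 64 by rewrite mulr_gt0.
  move=> mK; rewrite -invfM ler_pdivlMr // /Lam; apply: le_trans mK.
  set Y := n%:R ^+ 2 in n1 *; set L := ln _ in L0 *.
  have : 0 <= K * (Y + L - 1) by rewrite mulr_ge0 ?ltW //; lra.
  nra.
have m0 : 0 < m%:R :> R.
  rewrite ltr0n lt0n; apply/negP => /eqP m0; move: m_rho; rewrite m0 mul0r.
  by move: n1 Lam0; lra.
have [pt ptP] := countable_superlevel_dense risk.
have [ss ssH ssopt] : exists2 ss, subsidy_scheme H ss &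
    forall sigma, subsidy_scheme H sigma -> risk ss <= risk sigma + eps / 4.
  apply: near_inf; [by rewrite divr_gt0| |exact: risk_ge0].
  by exists (fun=> 0) => i; rewrite lexx /=; have := H_ge1; lra.
have cardS : (#|{: profile n}| <= 2 ^ n)%N by rewrite card_ffun card_bool card_ord.
pose F t sigma := loss_prior (G t) sigma / B.
pose F' t sigma := 1 - F t sigma.
pose tau t := threshold (G t).
have mF sigma : measurable_fun setT (F ^~ sigma) by exact: measurable_funM.
have mF' sigma : measurable_fun setT (F' ^~ sigma) by exact: measurable_funB.
have F'01 t sigma : 0 <= F' t sigma <= 1.
  by have := loss01 t sigma; rewrite -/(F t sigma) /F' => /andP[? ?]; apply/andP; split; lra.
have Fss t sigma sigma' :
    (forall i s, (tau t i s < sigma i) = (tau t i s < sigma' i) /\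
               (tau t i s <= sigma i) = (tau t i s <= sigma' i)) ->
    F t sigma = F t sigma'.
  by move=> h; rewrite /F (loss_prior_same_side h).
have F'ss t sigma sigma' :
    (forall i s, (tau t i s < sigma i) = (tau t i s < sigma' i) /\
               (tau t i s <= sigma i) = (tau t i s <= sigma' i)) ->
    F' t sigma = F' t sigma'.
  by move=> h; rewrite /F' (Fss _ _ _ h).
pose U1 := \bigcup_k underestimated P F X rho (pt k).
(* A constant family turns the countable bound into one for the single vector [ss]. *)
pose U2 := \bigcup_(k : nat) underestimated P F' X rho ss.
have mU1 : measurable U1.
  by apply: bigcup_measurable => k _; exact: (measurable_underestimated mF iidX).
have mU2 : measurable U2.
  by apply: bigcup_measurable => k _; exact: (measurable_underestimated mF' iidX).
have QU1 : (Q U1 <= (expR (- Lam))%:E)%E.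
  exact: (bigcup_underestimated n_gt0 cardS loss01 mF Fss iidX rho0 Lam0 m_rho).
have QU2 : (Q U2 <= (expR (- Lam))%:E)%E.
  exact: (bigcup_underestimated n_gt0 cardS F'01 mF' F'ss iidX rho0 Lam0 m_rho).
have mU : measurable (U1 `|` U2) by exact: measurableU.
exists (~` (U1 `|` U2)); split; [exact: measurableC|split].
  rewrite probability_setC // EFinB leeB //.
  apply: (le_trans (measureU2 _ mU1 mU2)); apply: (le_trans (leeD QU1 QU2)).
  rewrite -EFinD lee_fin /Lam opprD expRD expRN lnK ?posrE ?invr_gt0 // invrK.
  have e2 : 2 <= expR 1 :> R by have := expR_ge1Dx (1 : R); lra.
  have : expR (- 1) <= 2^-1 :> R by rewrite expRN lef_pV2 ?posrE ?expR_gt0.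
  by move: delta_gt0; nra.
move=> om; rewrite setCU => -[nU1 nU2] sh shH sherm sigma sigmaH.
(* The test vector [pt k] lies close enough to [sh] that its empirical loss is no larger, while its
   risk is at least that of [sh] minus eps / 4. The chain sh, pt k, ss, sigma loses eps / 4 four
   times. *)
have [r r0 usc] := loss_prior_usc (fun j => G (X j om)) sh.
have [k [near lev]] := ptP sh r (eps / 4) r0 ltac:(by rewrite divr_gt0).
have rhoB : rho * B = eps / 4 by rewrite /rho; field; rewrite gt_eqF.
have sumF sig : \sum_(j < m) F (X j om) sig = m%:R * emp om sig / B.
  rewrite /emp /emp_loss mulrA divff ?mul1r ?gt_eqF //.
  by rewrite mulr_suml.
have emp_pt : risk (pt k) - eps / 4 <= emp om (pt k).
  have : ~ underestimated P F X rho (pt k) om by move=> h; apply: nU1; exists k.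
  rewrite /underestimated /= scaled_risk sumF => /negP; rewrite -leNgt -mulrA ler_pM2l //.
  by rewrite ler_pdivlMr // mulrBl rhoB mulfVK ?gt_eqF.
have emp_ss : emp om ss <= risk ss + eps / 4.
  have : ~ underestimated P F' X rho ss om by move=> h; apply: nU2; exists 0%N.
  rewrite /underestimated /= scaled_gain big_split /= sumrN sumF sumr_const card_ord.
  move/negP; rewrite -leNgt -[X in X - _]mulr1 -[1 *+ m]/(m%:R) mulr1 -mulrA.
  rewrite -{2}[m%:R]mulr1 -mulrBr ler_pM2l // -(ler_pM2r B_gt0) !mulrBl rhoB !mulfVK ?gt_eqF //.
  by lra.
have emp_sh : emp om (pt k) <= emp om sh.
  by rewrite /emp /emp_loss ler_pM2l ?invr_gt0 //; apply: ler_sum => j _; exact: usc.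
have := sherm ss ssH; have := ssopt sigma sigmaH; lra.
Qed.

End Learning.

Theorem theorem10 (R : realType) :
  exists c : R, 0 < c /\
  forall (n : nat) (H eps delta : R), 1 <= H -> 0 < eps -> 0 < delta ->
  forall (d : measure_display) (T : measurableType d) (P : probability T R)
         (G : T -> cmgame R n),
    (forall t, valid_game H (G t)) ->
    (forall sigma : 'I_n -> R,
        measurable_fun setT (fun t => loss_prior (G t) sigma)) ->
  forall (d' : measure_display) (Omega : measurableType d')
         (Q : probability Omega R) (m : nat) (X : 'I_m -> Omega -> T),
    iid_sample P Q X ->
    c * ((n%:R ^+ 2 * H ^+ 2) / eps ^+ 2) * (n%:R ^+ 2 + ln (delta^-1)) <= m%:R ->
    exists E : set Omega, measurable E /\ ((1 - delta)%:E <= Q E)%E /\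
      forall omega, E omega ->
      forall sighat : 'I_n -> R, subsidy_scheme H sighat ->
        (forall sigma, subsidy_scheme H sigma ->
           emp_loss (fun j => G (X j omega)) sighat
             <= emp_loss (fun j => G (X j omega)) sigma) ->
        forall sigma, subsidy_scheme H sigma ->
          (\int[P]_t (loss_prior (G t) sighat)%:E
             <= \int[P]_t (loss_prior (G t) sigma)%:E + eps%:E)%E.
Proof.
exists (256 * 256 * 128); split; first by rewrite !mulr_gt0.
move=> n H eps delta H1 eps0 delta0 d T P G vG mG d' Omega Q m X iidX m_large.
(* For [delta >= 1] the empty event is likely enough. *)
have [delta1|delta1] := leP 1 delta.
  exists set0; split => //; split => //.
  by rewrite measure0 lee_fin subr_le0.
(* Without agents the bound 2nH forces every loss to vanish. *)
have [n_eq0|n_gt0] := posnP n.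
  exists setT; split => //; split.
    by rewrite probability_setT lee_fin gerBl ltW.
  move=> omega _ sighat _ _ sigma _.
  have loss0 sig : (\int[P]_t (loss_prior (G t) sig)%:E)%E = 0%E.
    apply: integral0_eq => t _; congr _%:E; apply/eqP.
    rewrite eq_le loss_prior_ge0 andbT.
    have n0 : n%:R = 0 :> R by rewrite n_eq0.
    by have := loss_prior_le sig H1 (vG t); rewrite n0 mulr0 mul0r.
  by rewrite !loss0 add0e lee_fin ltW.
have [E [mE [QE EP]]] := erm_generalizes H1 n_gt0 vG mG iidX eps0 delta0 delta1 m_large.
exists E; split => //; split => // omega Eo sighat shH sherm sigma sigmaH.
rewrite !(riskE P H1 vG mG) -EFinD lee_fin.
exact: EP Eo _ shH sherm _ sigmaH.
Qed.
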